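(* Let $C_4$ be the cycle with vertex set $V=\{0,1,2,3\}$ and $i\sim j$ if and only if $i-j\equiv\pm1\pmod 4$, with edge weight $w\equiv1$. Let $m_0:V\to\mathbb{R}_+$ and let $m\in C^\infty([0,T)\times V,\mathbb{R}_+)$ be a solution to the Bakry-Émery Ricci flow (with $n=\infty$) $$\partial_t m(t,i)=-\mathrm{Ric}_{m(t,\cdot)}(i),\qquad m(0,i)=m_0(i),\qquad i\in V.$$ Then $$T\le\frac{\max_{x\in V}m_0(x)^2}{4}.$$
   Context: $\mathbb{R}_+=(0,\infty)$. Write $y\sim x$ if $\{x,y\}$ is an edge. For a vertex weight $m:V\to\mathbb{R}_+$ (edge weight $\equiv1$) and $f,g:V\to\mathbb{R}$ define $$\Delta f(x)=\frac{1}{m(x)}\sum_{y\sim x}(f(y)-f(x)),\qquad \Gamma(f,g)=\tfrac12\big(\Delta(fg)-f\Delta g-g\Delta f\big),$$ $$\Gamma(f)=\Gamma(f,f),\qquad \Gamma_2(f)=\tfrac12\Delta\Gamma(f)-\Gamma(\Delta f,f).$$ The ($\infty$-dimensional) Bakry-Émery curvature $\mathrm{Ric}_m(x)$ is the maximal $K\in\mathbb{R}$ such that $\Gamma_2(f)(x)\ge K\,\Gamma(f)(x)$ for all $f:V\to\mathbb{R}$. $C^\infty([0,T)\times V,\mathbb{R}_+)$ denotes functions $m:[0,T)\times V\to\mathbb{R}_+$ such that $t\mapsto m(t,x)$ is smooth for every $x\in V$. *)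

(* Defs.v *)
From HB Require Import structures.
From mathcomp Require Import all_boot all_order all_algebra.
From mathcomp Require Import all_classical all_reals all_analysis.

Set Implicit Arguments.
Unset Strict Implicit.
Unset Printing Implicit Defensive.

Import Order.TTheory GRing.Theory Num.Theory.
Import numFieldNormedType.Exports.

Local Open Scope classical_set_scope.
Local Open Scope ring_scope.

Section BakryEmery.
Variables (R : realType) (V : finType) (adj : rel V) (m : V -> R).
Implicit Types f g : V -> R.

Definition laplacian f (x : V) : R :=
  (m x)^-1 * \sum_(y | adj x y) (f y - f x).

Definition gamma f g (x : V) : R :=
  (laplacian (fun y => f y * g y) x
   - f x * laplacian g x - g x * laplacian f x) / 2.

Definition gamma2 f (x : V) : R :=
  laplacian (gamma f f) x / 2 - gamma (laplacian f) f x.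

Definition curvature_bounds (x : V) : set R :=
  [set K | forall f, gamma2 f x >= K * gamma f f x].

(* Ric_m(x) = K, stated as a relation so that no junk value enters when the
   maximum is not attained; the maximum is unique when it exists. *)
Definition is_ricci (x : V) (K : R) : Prop :=
  curvature_bounds x K /\ ubound (curvature_bounds x) K.

End BakryEmery.

Section TimeRegularity.
Variable R : realType.

Definition time_dom (T : \bar R) : set R := [set t | 0 <= t /\ (t%:E < T)%E].

(* Derivative relative to D: two-sided at interior points of [0, T[, and
   one-sided (from the right) at 0. *)
Definition has_deriv_within (D : set R) (f : R -> R) (t l : R) : Prop :=
  (f s - f t) / (s - t) @[s --> within D t^'] --> l.

(* F k is the k-th derivative of f on D. *)
Definition smooth_on (D : set R) (f : R -> R) : Prop :=
  exists2 F : nat -> R -> R,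
    F 0%N = f &
    forall (k : nat) (t : R), D t -> has_deriv_within D (F k) t (F k.+1 t).

End TimeRegularity.

(* C^oo([0, T[ x V, R_+) with R_+ = ]0, +oo[; values of m outside [0, T[ are
   unconstrained. *)
Definition smooth_weights (R : realType) (V : finType) (T : \bar R)
    (m : R -> V -> R) : Prop :=
  (forall t x, time_dom T t -> 0 < m t x) /\
  (forall x, smooth_on (time_dom T) (fun t => m t x)).

Definition ricci_flow (R : realType) (V : finType) (adj : rel V) (T : \bar R)
    (m0 : V -> R) (m : R -> V -> R) : Prop :=
  (forall x, m 0 x = m0 x) /\
  (forall t x, time_dom T t ->
     exists2 K, is_ricci adj (m t) x K &
       has_deriv_within (time_dom T) (fun s => m s x) t (- K)).

Definition C4_adj : rel 'I_4 := fun i j =>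
  ((i%:Z - j%:Z == 1 %[mod 4])%Z || (i%:Z - j%:Z == -1 %[mod 4])%Z).

(* Main.v *)
(** At a vertex [x] of [C4] whose weight is maximal, [Gamma2 - (2 / m x) Gamma]
    is a sum of squares, so [Ric x >= 2 / m x]. Hence the square of the maximal
    weight decreases at rate at least 4 along the flow, and it stays positive.
    The maximum principle is applied to [m^2 + c t] with [c < 4]: at a maximum
    over space and [[0, t1]] attained at a positive time, the left difference
    quotients of this function would force its derivative to be nonnegative. *)
Require Import Defs.
From mathcomp Require Import all_boot all_order all_algebra.
From mathcomp Require Import all_classical all_reals all_analysis.
From mathcomp Require Import ring lra.
Import Order.TTheory GRing.Theory Num.Theory.
Import numFieldNormedType.Exports.
Local Open Scope ring_scope.

Lemma C4_adjE (x y : 'I_4) : C4_adj x y = (y == x + 1) || (y == x - 1).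
Proof.
by case: x => [[|[|[|[|x]]]] //= hx]; case: y => [[|[|[|[|y]]]] //= hy].
Qed.

Lemma C4_laplacianE (R : realType) (m f : 'I_4 -> R) (x : 'I_4) :
  laplacian C4_adj m f x = (m x)^-1 * (f (x + 1) + f (x - 1) - 2 * f x).
Proof.
rewrite /laplacian (eq_bigl _ _ (C4_adjE x)) (bigD1 (x + 1)) ?eqxx //=.
rewrite (big_pred1 (x - 1)) => [|y /=]; first by congr (_ * _); ring.
have : x - 1 != x + 1 by case: x => [[|[|[|[|x]]]] //= hx].
by case: (eqVneq y (x - 1)) => [-> ->|_ _]; rewrite ?orbT // orbF andbN.
Qed.

Lemma C4_curvature_at_max (R : realType) (m : 'I_4 -> R) (x : 'I_4) :
  (forall y, 0 < m y) -> (forall y, m y <= m x) ->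
  curvature_bounds C4_adj m x (2 / m x).
Proof.
move=> m_gt0 m_le f /=.
(* The length of the cycle enters here: both two-step walks away from [x] end at the same antipodal
   vertex, so only four values of [f] occur. *)
have xD : x - 1 - 1 = x + 1 + 1 :> 'I_4.
  by case: x {m_le} => [[|[|[|[|x]]]] //= hx]; apply/val_inj.
rewrite /gamma2 /gamma !C4_laplacianE !addrK !subrK xD.
have ip_gt0 : 0 < (m x)^-1 by rewrite invr_gt0.
have inv_le y : (m x)^-1 <= (m y)^-1 by rewrite lef_pV2 ?posrE.
move: (inv_le (x + 1)) (inv_le (x - 1)) ip_gt0 => {inv_le m_gt0 m_le xD}.
move: (m x)^-1 (m (x + 1))^-1 (m (x - 1))^-1 => p q r pq pr p_gt0.
move: (f x) (f (x + 1)) (f (x - 1)) (f (x + 1 + 1)) => o a' b' c'.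
rewrite -subr_ge0.
(* Adding a constant to [f] changes neither side, so values are taken relative to [f x]. *)
set a := a' - o; set b := b' - o; set c := c' - o.
set lhs := (X in 0 <= X).
(* [p], [q], [r] are the inverse weights at [x], [x + 1], [x - 1]; maximality of [m x] makes [q - p]
   and [r - p] nonnegative. *)
have -> : lhs = p / 4 * ((q - p) * ((c - 2 * a) ^+ 2 + 2 * a ^+ 2)
    + (r - p) * ((c - 2 * b) ^+ 2 + 2 * b ^+ 2) + 2 * p * (c - a - b) ^+ 2).
  by rewrite /lhs /a /b /c; field.
apply: mulr_ge0; first by rewrite divr_ge0 ?ltW.
have sq_ge0 (u v : R) : 0 <= u ^+ 2 + 2 * v ^+ 2.
  by rewrite addr_ge0 ?sqr_ge0 // mulr_ge0 ?sqr_ge0.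
apply: addr_ge0; first by apply: addr_ge0; apply: mulr_ge0; rewrite ?subr_ge0.
by apply: mulr_ge0; rewrite ?sqr_ge0 ?mulr_ge0 ?ltW.
Qed.

Section DerivWithin.
Context {R : realType}.
Local Open Scope classical_set_scope.
Implicit Types (D E : set R) (f : R -> R) (t l : R).

Lemma has_deriv_within_cvg {D f t l} :
  has_deriv_within D f t l -> f s @[s --> within D t^'] --> f t.
Proof.
move=> df.
have ids : s - t @[s --> within D t^'] --> 0.
  have idt : s @[s --> within D t^'] --> t.
    by apply: cvg_within_filter; apply/(continuous_withinNx id); exact: cvg_id.
  by rewrite -(subrr t); exact: (cvgB idt (cvg_cst t)).
have h : (f s - f t) / (s - t) * (s - t) + f t @[s --> within D t^'] --> f t.
  by rewrite -[X in _ --> X]add0r -(mulr0 l);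
    exact: cvgD (cvgM df ids) (cvg_cst _).
apply: cvg_trans h; apply: (near_eq_cvg (F := within D t^')).
apply: cvg_within; near=> s.
rewrite /= divfK ?subrK // subr_eq0.
by near: s; exact: nbhs_dnbhs_neq.
Unshelve. all: by end_near. Qed.

Lemma has_deriv_within_sqr {D f t l} : has_deriv_within D f t l ->
  has_deriv_within D (fun s => f s ^+ 2) t (2 * f t * l).
Proof.
move=> df; have cf := has_deriv_within_cvg df.
(* The quotient of [f ^+ 2] factors as a difference of squares. *)
have h : (f s + f t) * ((f s - f t) / (s - t)) @[s --> within D t^']
    --> 2 * f t * l.
  by rewrite mulr_natl mulr2n; exact: cvgM (cvgD cf (cvg_cst _)) df.
apply: cvg_trans h.
by apply: (near_eq_cvg (F := within D t^')); near=> s; rewrite /=; ring.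
Unshelve. all: by end_near. Qed.

Lemma has_deriv_withinD_linear {D f t l} (c : R) : has_deriv_within D f t l ->
  has_deriv_within D (fun s => f s + c * s) t (l + c).
Proof.
move=> df.
have h : (f s - f t) / (s - t) + c @[s --> within D t^'] --> l + c.
  by apply: cvgD; [exact: df|exact: cvg_cst].
apply: cvg_trans h; apply: (near_eq_cvg (F := within D t^')).
apply: cvg_within; near=> s.
have st : s - t != 0 by rewrite subr_eq0; near: s; exact: nbhs_dnbhs_neq.
by rewrite /=; field.
Unshelve. all: by end_near. Qed.

Lemma has_deriv_within_continuous {D E f} (f' : R -> R) : E `<=` D ->
  (forall t, E t -> has_deriv_within D f t (f' t)) ->
  {within E, continuous f}.
Proof.
move=> ED df; apply/subspace_continuousP => t Et A Aft.
have := has_deriv_within_cvg (df t Et) A Aft.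
rewrite /= /within /dnbhs /within /= !nbhs_nearE /=.
apply: (@filterS _ (nbhs t)) => s sP Es /=.
(* The punctured limit says nothing at [s = t], where [f t] lies in its own neighbourhood [A]. *)
have [->|st] := eqVneq s t; first exact: nbhs_singleton.
exact: sP st (ED _ Es).
Qed.

(** For [s] left of [t] both numerator and denominator are nonpositive. Using one side only covers a
    maximum at the right end of a time interval. *)
Lemma has_deriv_within_left_max_ge0 {D f a t l} :
  has_deriv_within D f t l -> a < t -> (forall s, a < s < t -> D s) ->
  (forall s, a < s < t -> f s <= f t) -> 0 <= l.
Proof.
move=> df a_t Dt ft.
have dl : (f s - f t) / (s - t) @[s --> t^'-] --> l.
  apply: cvg_trans df; apply: cvg_app => A [e e0 eA].
  near=> s; apply: eA => /=.
  - near: s; apply: cvg_within; exact: nbhsx_ballx.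
  - by rewrite lt_eqF.
  - by apply: Dt; apply/andP; split=> //; near: s; exact: nbhs_left_gt.
apply: (cvgr_to_ge dl); near=> s.
have st : s - t < 0 by rewrite subr_lt0.
rewrite ler_ndivlMr// mul0r subr_le0 ft //.
by apply/andP; split=> //; near: s; exact: nbhs_left_gt.
Unshelve. all: by end_near. Qed.

End DerivWithin.

Theorem theorem3p7 (R : realType) (T : \bar R) (m0 : 'I_4 -> R)
    (m : R -> 'I_4 -> R)
    (T_gt0 : (0 < T)%E)
    (m0_gt0 : forall x, 0 < m0 x)
    (m_smooth : smooth_weights T m)
    (m_flow : ricci_flow C4_adj T m0 m) :
  (T <= ((\big[Num.max/0]_(x : 'I_4) (m0 x ^+ 2)) / 4)%:E)%E.
Proof.
set M := \big[_/_]_x _.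
have M_ge x : m0 x ^+ 2 <= M by exact: le_bigmax.
have M_gt0 : 0 < M by apply: lt_le_trans (M_ge ord0); exact: exprn_gt0.
rewrite leNgt; apply/negP => MT.
(* A finite time is needed for a compact interval, and [T] may be infinite. *)
have [t1 Mt1 t1T] : exists2 t1 : R, M / 4 < t1 & (t1%:E < T)%E.
  case: T MT {T_gt0 m_smooth m_flow} => [T| |] //; last first.
    by exists (M / 4 + 1); rewrite ?ltry // ltrDl.
  by rewrite lte_fin => MT; exists ((M / 4 + T) / 2); rewrite ?lte_fin midf_lt.
have t1_gt0 : 0 < t1 by apply: lt_trans Mt1; rewrite divr_gt0.
have domP t : 0 <= t <= t1 -> time_dom T t.
  by move=> /andP[t0 tt1]; split=> //; apply: le_lt_trans t1T; rewrite lee_fin.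
have [m_gt0 _] := m_smooth; have [m_init ricci] := m_flow.
(* With this slope, [m^2 + c t] exceeds its initial bound [M] at time [t1]. *)
pose c := M / t1.
have c_lt4 : c < 4 by rewrite ltr_pdivrMr // -ltr_pdivrMl // mulrC.
pose phi x t := m t x ^+ 2 + c * t.
have dphi x t : time_dom T t -> exists2 K, is_ricci C4_adj (m t) x K &
    has_deriv_within (time_dom T) (phi x) t (2 * m t x * (- K) + c).
  move=> /(ricci t x)[K Kric dm]; exists K => //.
  exact/has_deriv_withinD_linear/has_deriv_within_sqr.
have max_phi x : exists2 s, s \in `[0, t1] &
    forall t, t \in `[0, t1] -> phi x t <= phi x s.
  apply: EVT_max; first exact: ltW.
  (* The default 0 outside the time domain makes the chosen derivative a total function. *)
  have /choice[f' f'P] t : exists l, time_dom T t ->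
      has_deriv_within (time_dom T) (phi x) t l.
    have [/(dphi x)[K _ dK]|nD] := pselect (time_dom T t).
      by exists (2 * m t x * (- K) + c).
    by exists 0.
  apply: (has_deriv_within_continuous f') => t; last move=> tt1; [|apply: f'P];
    exact: domP.
have /choice[s sP] : forall x, exists s, s \in `[0, t1] /\
    forall t, t \in `[0, t1] -> phi x t <= phi x s.
  by move=> x; have [s s1 s2] := max_phi x; exists s.
pose x := [arg max_(x > ord0) phi x (s x)]%O.
have phi_le y t : t \in `[0, t1] -> phi y t <= phi x (s x).
  move=> /(sP y).2 /le_trans; apply; rewrite /x.
  by case: Order.TotalTheory.arg_maxP => // i _; apply.
have s_dom := domP _ (sP x).1.
(* A maximum at time 0 would be at most [M], whereas [phi x t1] is [M] plus a positive square. *)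
have [sx0|sx_neq0] := eqVneq (s x) 0.
  have t1_in : t1 \in `[0, t1] by rewrite in_itv /= lexx ltW.
  have := phi_le x t1 t1_in.
  rewrite sx0 /phi m_init mulr0 addr0 divfK ?gt_eqF // leNgt => /negP; apply.
  rewrite (le_lt_trans (M_ge x)) // ltrDr exprn_gt0 // m_gt0 //.
  by apply: domP; rewrite lexx ltW.
have sx_gt0 : 0 < s x.
  by rewrite lt_neqAle eq_sym sx_neq0; have := (sP x).1;
    rewrite in_itv => /andP[].
have [K [_ K_ub] dK] := dphi x _ s_dom.
(* At the fixed time [s x] the term [c * s x] is common to all vertices, so maximality of [phi] is
   maximality of the weight at [x]. *)
have K_ge : 2 / m (s x) x <= K.
  apply: K_ub; apply: C4_curvature_at_max => y; first exact: m_gt0.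
  have := phi_le y _ (sP x).1; rewrite lerD2r.
  by rewrite ler_sqr // nnegrE ltW ?m_gt0.
have m_pos := m_gt0 _ x s_dom.
have : 0 <= 2 * m (s x) x * (- K) + c.
  have itv_left t : 0 < t < s x -> t \in `[0, t1].
    move=> /andP[t_gt0 /ltW t_s]; rewrite in_itv /= ltW //=.
    by apply: le_trans t_s _; have := (sP x).1; rewrite in_itv => /andP[].
  by apply: (has_deriv_within_left_max_ge0 dK sx_gt0) => t /itv_left;
    [exact: domP|exact: (sP x).2].
(* Since [2 <= K * m (s x) x], the derivative is at most [c - 4 < 0]. *)
by move: K_ge; rewrite ler_pdivrMr //; nra.
Qed.
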